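(* Let $X \subseteq \mathbb{C}^{n\times n}$ be an affine variety, let $P,Q,R \in \mathbb{C}^{n\times n}$, and let $r \geq 1$ be an integer. Assume that $\operatorname{rank}(\nabla_Q(M)) \leq r$ for each $M \in X$. \begin{itemize} \item[(i)] If $\operatorname{rank}(\nabla_{P,Q}(M)) \leq r$ for each $M \in X$, then, for every $A \in \mathbb{C}^{n\times n}$, $$\underline{\mathbf{FL}}_X(A) \geq \left\lceil \frac{\operatorname{rank}(\nabla_{P,Q}(A))}{r} \right\rceil.$$ \item[(ii)] If $\operatorname{rank}(\nabla_{Q,R}(M)) \leq r$ for each $M \in X$, then, for every $A \in \mathbb{C}^{n\times n}$, $$\underline{\mathbf{FL}}_X(A) \geq \left\lceil \frac{\operatorname{rank}(\nabla_{Q,R}(A))}{r} \right\rceil.$$ \end{itemize}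
   Context: For $P,Q \in \mathbb{C}^{n\times n}$, the displacement operator is $\nabla_{P,Q}:\mathbb{C}^{n\times n}\to\mathbb{C}^{n\times n}$, $A \mapsto PA - AQ$; write $\nabla_Q = \nabla_{Q,Q}$. For an affine variety $X \subseteq \mathbb{C}^{n\times n}$ and an integer $k \geq 1$, let $\mu_k(X)$ be the Zariski closure in $\mathbb{C}^{n\times n}$ of $\{M_1\cdots M_k : M_1,\dots,M_k \in X\}$. The border $X$-factorization length of $A$ is $\underline{\mathbf{FL}}_X(A) = \min\{k \geq 1 : A \in \mu_k(X)\}$, with $\underline{\mathbf{FL}}_X(A) = \infty$ if $A \notin \mu_k(X)$ for all $k \geq 1$. *)

(* Defs.v *)
From HB Require Import structures.
From mathcomp Require Import all_boot all_order all_algebra.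
From mathcomp Require Import complex mpoly.
From mathcomp Require Import boolp classical_sets reals constructive_ereal.

Set Implicit Arguments.
Unset Strict Implicit.
Unset Printing Implicit Defensive.

Import Order.TTheory GRing.Theory Num.Theory.

Local Open Scope classical_set_scope.
Local Open Scope ring_scope.

Definition displacement (K : fieldType) (n : nat) (P Q A : 'M[K]_n) : 'M[K]_n :=
  P *m A - A *m Q.

(* Polynomial functions on n x n matrices are polynomials in the n * n entries,
   enumerated by [mxvec]. *)
Definition zariski_closed (K : fieldType) (n : nat) (X : set 'M[K]_n) : Prop :=
  exists S : set {mpoly K[n * n]},
    X = [set A | forall p, S p -> p.@[fun i => mxvec A 0 i] = 0].

Definition zariski_closure (K : fieldType) (n : nat) (Y : set 'M[K]_n) :
    set 'M[K]_n :=
  smallest (@zariski_closed K n) Y.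

Definition mu (K : fieldType) (n k : nat) (X : set 'M[K]_n) : set 'M[K]_n :=
  zariski_closure
    [set \prod_(i < k) M i | M in [set M : 'I_k -> 'M[K]_n | forall i, X (M i)]].

Definition border_FL (K : fieldType) (n : nat) (X : set 'M[K]_n) (A : 'M[K]_n) :
    \bar int :=
  match pselect (exists k : nat, (1 <= k)%N && `[< mu k X A >]) with
  | left exk => ((ex_minn exk)%:Z)%:E
  | right _ => +oo%E
  end.

(* Main.v *)
Require Import Defs.
From HB Require Import structures.
From mathcomp Require Import all_boot all_order all_algebra.
From mathcomp Require Import complex mpoly.
From mathcomp Require Import boolp classical_sets reals constructive_ereal.
From mathcomp Require Import zify.

(** The displacement operator obeys a Leibniz rule through any intermediate
    matrix: nabla_{P,S}(AB) = nabla_{P,Q}(A) B + A nabla_{Q,S}(B)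
    ([displacementM]).  Expanding a product of k elements of X with Q as the
    intermediate matrix everywhere leaves k summands, each of rank at most r:
    one of them involves nabla_{P,Q} (the first factor) or nabla_{Q,R} (the last
    factor), the others nabla_{Q,Q}.  Hence products of k factors have
    displacement rank at most k r.

    This bound passes to the Zariski closure, because rank at most m is a
    polynomial condition: it says that det (U B V) = 0 for all U with m + 1 rows
    and V with m + 1 columns ([mxrank_leP_det]), and when B is the displacement
    of A this determinant is a polynomial in the entries of A
    ([zariski_closed_displacement_rank]).  So A in mu_k(X) forces the
    displacement rank of A to be at most k r, which is the claimed lower bound
    on k. *)

Set Implicit Arguments.
Unset Strict Implicit.
Unset Printing Implicit Defensive.

Import Order.TTheory GRing.Theory Num.Theory.

Local Open Scope classical_set_scope.
Local Open Scope ring_scope.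

Lemma displacementM (K : fieldType) (n : nat) (P Q S A B : 'M[K]_n) :
  displacement P S (A *m B) =
    displacement P Q A *m B + A *m displacement Q S B.
Proof.
by rewrite /displacement mulmxBl mulmxBr !mulmxA addrA subrK.
Qed.

Lemma displacement1 (K : fieldType) (n : nat) (Q : 'M[K]_n) :
  displacement Q Q 1%:M = 0.
Proof. by rewrite /displacement mulmx1 mul1mx subrr. Qed.

Lemma mxrank_displacementM (K : fieldType) (n : nat) (P Q S A B : 'M[K]_n) :
  (\rank (displacement P S (A *m B)) <=
     \rank (displacement P Q A) + \rank (displacement Q S B))%N.
Proof.
rewrite (displacementM _ Q); apply: leq_trans (mxrank_add _ _) _.
by apply: leq_add; [exact: mxrankM_maxl | exact: mxrankM_maxr].
Qed.

Lemma mxrank_displacement_prod (K : fieldType) (n k r : nat) (Q : 'M[K]_n)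
    (M : 'I_k -> 'M[K]_n) :
  (forall i, (\rank (displacement Q Q (M i)) <= r)%N) ->
  (\rank (displacement Q Q (\prod_(i < k) M i)) <= k * r)%N.
Proof.
elim: k M => [|k IHk] M hM; first by rewrite big_ord0 displacement1 mxrank0.
rewrite big_ord_recl mulSn; apply: leq_trans (mxrank_displacementM _ Q _ _ _) _.
by rewrite leq_add ?hM ?IHk.
Qed.

(** The vanishing of all (m + 1)-minors, with arbitrary U and V in place of row
    and column selections.  If the rank is larger than m, the factorization of B
    given by Gaussian elimination provides U and V with U B V = 1. *)
Lemma mxrank_leP_det (K : fieldType) (p q m : nat) (B : 'M[K]_(p, q)) :
  (\rank B <= m)%N <->
  (forall (U : 'M[K]_(m.+1, p)) (V : 'M[K]_(q, m.+1)), \det (U *m B *m V) = 0).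
Proof.
split=> [rkB U V | det0].
  apply/eqP; apply: contraTT rkB; rewrite -unitfE -unitmxE -row_free_unit.
  rewrite -ltnNge => /eqP <-.
  by apply: leq_trans (mxrankM_maxl _ _) _; exact: mxrankM_maxr.
rewrite leqNgt; apply/negP => ltmB.
pose U : 'M[K]_(m.+1, p) := pid_mx m.+1 *m invmx (col_ebase B).
pose V : 'M[K]_(q, m.+1) := invmx (row_ebase B) *m pid_mx m.+1.
suff UBV1 : U *m B *m V = 1%:M.
  by move: (det0 U V); rewrite UBV1 det1 => /eqP; rewrite oner_eq0.
rewrite -[X in U *m X](mulmx_ebase B) /U /V !mulmxA mulmxKV ?col_ebase_unit //.
rewrite mulmxK ?row_ebase_unit //.
have leBp := rank_leq_row B; have leBq := rank_leq_col B.
rewrite !mul_pid_mx -pid_mx_1; congr pid_mx; lia.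
Qed.

(** The witnessing polynomials are the determinants of [mxrank_leP_det] taken on
    the displacement of the generic matrix; evaluating at the entries of A is a
    ring morphism, hence commutes with matrix products and determinants. *)
Lemma zariski_closed_displacement_rank (K : fieldType) (n m : nat)
    (P Q : 'M[K]_n) :
  zariski_closed [set A : 'M[K]_n | (\rank (displacement P Q A) <= m)%N].
Proof.
pose C a b (M : 'M[K]_(a, b)) := map_mx (@mpolyC (n * n) K) M.
pose G : 'M[{mpoly K[n * n]}]_n := \matrix_(i, j) 'X_(mxvec_index i j).
pose D := C _ _ P *m G - G *m C _ _ Q.
pose p (UV : 'M[K]_(m.+1, n) * 'M[K]_(n, m.+1)) :=
  \det (C _ _ UV.1 *m D *m C _ _ UV.2).
have pE UV (A : 'M[K]_n) : (p UV).@[fun i => mxvec A 0 i] =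
    \det (UV.1 *m displacement P Q A *m UV.2).
  have CK a b (M : 'M_(a, b)) :
      map_mx (meval (fun i => mxvec A 0 i)) (C _ _ M) = M.
    by apply/matrixP=> i j; rewrite !mxE mevalC.
  have GK : map_mx (meval (fun i => mxvec A 0 i)) G = A.
    by apply/matrixP=> i j; rewrite !mxE mevalXU mxvecE.
  by rewrite -det_map_mx !map_mxM map_mxB !map_mxM !CK GK.
exists (range p); apply/seteqP; split=> A /=.
  by move=> /mxrank_leP_det det0 _ [UV _ <-]; rewrite pE.
move=> pA0; apply/mxrank_leP_det => U V; rewrite -(pE (U, V)).
by apply: pA0; exists (U, V).
Qed.

Lemma zariski_closure_sub (K : fieldType) (n : nat) (Y Z : set 'M[K]_n) :
  zariski_closed Z -> Y `<=` Z -> zariski_closure Y `<=` Z.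
Proof. exact: smallest_sub. Qed.

(** The index [k.+1] excludes the empty product: that is the identity matrix,
    whose displacement P - Q can have any rank. *)
Lemma ceil_rank_le_border_FL (F : realType) (n r : nat) (X : set 'M[F[i]]_n)
    (P Q A : 'M[F[i]]_n) :
  (1 <= r)%N ->
  (forall k (M : 'I_k.+1 -> 'M[F[i]]_n), (forall i, X (M i)) ->
     (\rank (displacement P Q (\prod_(i < k.+1) M i)) <= k.+1 * r)%N) ->
  ((Num.ceil ((\rank (displacement P Q A))%:R / r%:R : F))%:E
     <= border_FL X A)%E.
Proof.
move=> r_gt0 rk_prod; rewrite /border_FL; case: pselect => [exk|_]; last first.
  exact: leey.
case: ex_minnP => -[//|k] /andP[_ /asboolP muA] _.
rewrite lee_fin ceil_le_int ler_pdivrMr ?ltr0n //.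
rewrite -[_%:~R]/(k.+1%:R) -natrM ler_nat.
have clZ := zariski_closed_displacement_rank (k.+1 * r) P Q.
apply: (zariski_closure_sub clZ) muA.
by move=> _ [M XM <-]; exact: rk_prod.
Qed.

Theorem theorem4p18 (F : realType) (n : nat) (X : set 'M[F[i]]_n)
    (P Q R : 'M[F[i]]_n) (r : nat)
    (hX : zariski_closed X) (hr : (1 <= r)%N)
    (hQ : forall M, X M -> (\rank (displacement Q Q M) <= r)%N) :
  ((forall M, X M -> (\rank (displacement P Q M) <= r)%N) ->
    forall A : 'M[F[i]]_n,
      ((Num.ceil ((\rank (displacement P Q A))%:R / r%:R : F))%:E
         <= border_FL X A)%E) /\
  ((forall M, X M -> (\rank (displacement Q R M) <= r)%N) ->
    forall A : 'M[F[i]]_n,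
      ((Num.ceil ((\rank (displacement Q R A))%:R / r%:R : F))%:E
         <= border_FL X A)%E).
Proof.
have hQprod k (M : 'I_k -> 'M[F[i]]_n) : (forall i, X (M i)) ->
    (\rank (displacement Q Q (\prod_(i < k) M i)) <= k * r)%N.
  by move=> XM; apply: mxrank_displacement_prod => i; exact: hQ.
split=> [hPQ | hQR] A; apply: ceil_rank_le_border_FL => // k M XM.
- rewrite big_ord_recl mulSn.
  apply: leq_trans (mxrank_displacementM _ Q _ _ _) _.
  by rewrite leq_add ?hPQ ?hQprod.
- rewrite big_ord_recr mulSn addnC.
  apply: leq_trans (mxrank_displacementM _ Q _ _ _) _.
  by rewrite leq_add ?hQR ?hQprod.
Qed.
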